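(* For any $d\ge 1$ and any closed convex polytope $B\subset\mathbb{R}^d$ there exists a constant $C_{d,B}$ such that for any set $P$ of $n$ points in $\mathbb{R}^d$, $\gamma_2(\mathcal{T}_B(P)) \le C_{d,B}(1+\log n)^d$.
   Context: For $K\subseteq\mathbb{R}^d$, $\mathcal{T}_K := \{tK + x : t>0,\ x\in\mathbb{R}^d\}$ and $\mathcal{T}_K(P) := \{F\cap P: F\in\mathcal{T}_K\}$. For a real matrix $A$, $\gamma_2(A) := \min\{\|U\|_{2\to\infty}\|V\|_{1\to 2} : A = UV\}$, where $\|U\|_{2\to\infty}$ is the largest Euclidean norm of a row of $U$ and $\|V\|_{1\to 2}$ the largest Euclidean norm of a column of $V$. For a set system $\mathcal{F}$, $\gamma_2(\mathcal{F}) := \gamma_2(A)$ where $A$ is the incidence matrix of $\mathcal{F}$ ($a_{ij}=1$ if the $j$-th point lies in the $i$-th set, else $0$). Logarithms are natural. *)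

(* Defs.v *)
From mathcomp Require Import all_boot all_order all_algebra finmap.
From mathcomp Require Import all_classical all_reals all_analysis.
Set Implicit Arguments.
Unset Strict Implicit.
Unset Printing Implicit Defensive.
Import Order.TTheory GRing.Theory Num.Theory numFieldNormedType.Exports.
Local Open Scope fset_scope.
Local Open Scope classical_set_scope.
Local Open Scope ring_scope.

Definition norm_2_oo (R : realType) (m k : nat) (U : 'M[R]_(m, k)) : R :=
  \big[Num.max/0]_(i < m) Num.sqrt (\sum_(j < k) U i j ^+ 2).

Definition norm_1_2 (R : realType) (k n : nat) (V : 'M[R]_(k, n)) : R :=
  \big[Num.max/0]_(j < n) Num.sqrt (\sum_(i < k) V i j ^+ 2).

(* The inner dimension k of the factorization is arbitrary. *)
Definition gamma2_values (R : realType) (m n : nat) (A : 'M[R]_(m, n)) : set R :=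
  [set g | exists (k : nat) (U : 'M[R]_(m, k)) (V : 'M[R]_(k, n)),
     A = U *m V /\ g = norm_2_oo U * norm_1_2 V].

(* The infimum is a minimum: see gamma2_attained and gamma2_lb below. *)
Definition gamma2 (R : realType) (m n : nat) (A : 'M[R]_(m, n)) : R :=
  inf (gamma2_values A).

Definition incidence_mx (R : realType) (E : choiceType)
    (P : {fset E}) (F : {fset {fset E}}) : 'M[R]_(#|{: F}|, #|{: P}|) :=
  \matrix_(i < #|{: F}|, j < #|{: P}|) (val (enum_val j) \in val (enum_val i))%:R.

Definition gamma2_sys (R : realType) (E : choiceType)
    (P : {fset E}) (F : {fset {fset E}}) : R :=
  gamma2 (incidence_mx R P F).

Definition homothets (R : realType) (d : nat) (K : set 'cV[R]_d) :
    set (set 'cV[R]_d) :=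
  [set F | exists (t : R) (x : 'cV[R]_d),
     0 < t /\ F = [set t *: y + x | y in K]].

(* The traces F `&` P, F in T, as a finite family (see traceP). *)
Definition trace (E : choiceType) (T : set (set E)) (P : {fset E}) :
    {fset {fset E}} :=
  [fset S in fpowerset P |
     `[< exists2 F : set E, T F & [set` S] = F `&` [set` P] >]].

Definition halfspace_intersection (R : realType) (d k : nat)
    (N : 'M[R]_(k, d)) (b : 'cV[R]_k) : set 'cV[R]_d :=
  [set y | forall i : 'I_k, (N *m y) i 0 <= b i 0].

Definition closed_convex_polytope (R : realType) (d : nat)
    (B : set 'cV[R]_d) : Prop :=
  bounded_set B /\
  exists (k : nat) (N : 'M[R]_(k, d)) (b : 'cV[R]_k),
    B = halfspace_intersection N b.

Lemma traceP (E : choiceType) (T : set (set E)) (P : {fset E}) (G : set E) :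
  (exists2 S : {fset E}, S \in trace T P & G = [set` S]) <->
  (exists2 F : set E, T F & G = F `&` [set` P]).
Proof.
split.
  by move=> [S]; rewrite !inE /= => /andP[_ /asboolP[F TF SF]] ->; exists F.
move=> [F TF ->].
pose S := [fset p in P | p \in F].
have SE : [set` S] = F `&` [set` P].
  apply/seteqP; split => x /=; rewrite !inE /=.
    by move=> /andP[-> /set_mem].
  by move=> [/mem_set -> ->].
exists S => //; rewrite !inE /=; apply/andP; split.
  by rewrite fpowersetE fset_sub.
by apply/asboolP; exists F.
Qed.

Lemma norm_2_oo_ge0 (R : realType) (m k : nat) (U : 'M[R]_(m, k)) :
  0 <= norm_2_oo U.
Proof. exact: bigmax_ge_id. Qed.

Lemma norm_1_2_ge0 (R : realType) (k n : nat) (V : 'M[R]_(k, n)) :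
  0 <= norm_1_2 V.
Proof. exact: bigmax_ge_id. Qed.

Lemma norm_1_2_tr (R : realType) (k n : nat) (V : 'M[R]_(k, n)) :
  norm_1_2 V = norm_2_oo V^T.
Proof.
rewrite /norm_1_2 /norm_2_oo; apply: eq_bigr => j _; congr Num.sqrt.
by apply: eq_bigr => i _; rewrite mxE.
Qed.

Lemma norm_2_oo_gram (R : realType) (m k l : nat) (U : 'M[R]_(m, k))
    (U' : 'M[R]_(m, l)) :
  U *m U^T = U' *m U'^T -> norm_2_oo U = norm_2_oo U'.
Proof.
move=> UU; apply: eq_bigr => i _; congr Num.sqrt.
have /matrixP/(_ i i) := UU; rewrite !mxE => UUi.
transitivity (\sum_j U i j * U^T j i).
  by apply: eq_bigr => j _; rewrite mxE.
by rewrite UUi; apply: eq_bigr => j _; rewrite mxE.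
Qed.

Lemma square_gram (R : realType) (N k : nat) (W : 'M[R]_(N, k)) :
  exists W' : 'M[R]_N, W *m W^T = W' *m W'^T.
Proof.
elim: N W => [|N IH] W; first by exists 0; rewrite !flatmx0.
rewrite -[N.+1]/(1 + N)%N in W *.
pose w := usubmx W; pose Y := dsubmx W.
pose s := (w *m w^T) 0 0; pose r := Num.sqrt s.
have ww : w *m w^T = s%:M by rewrite [LHS]mx11_scalar.
have sE : s = \sum_j w 0 j ^+ 2.
  by rewrite /s mxE; apply: eq_bigr => j _; rewrite [w^T _ _]mxE -expr2.
have s0 : 0 <= s by rewrite sE sumr_ge0// => j _; rewrite sqr_ge0.
have rr : r * r = s by rewrite -expr2 sqr_sqrtr.
have w0 : r = 0 -> w = 0.
  move=> r0; apply/rowP => j; rewrite [RHS]mxE.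
  have /eqP := rr; rewrite r0 mulr0 eq_sym sE psumr_eq0; last first.
    by move=> i _; rewrite sqr_ge0.
  by move=> /allP/(_ j (mem_index_enum _)); rewrite /= sqrf_eq0 => /eqP.
pose c := r^-1 *: (Y *m w^T).
pose Z := Y - s^-1 *: (Y *m w^T *m w).
have [Z' ZZ'] := IH Z.
exists (block_mx r%:M 0 c Z').
have YwE : r *: c = Y *m w^T.
  have [r0|r0] := eqVneq r 0.
    by rewrite w0// trmx0 mulmx0 r0 scale0r.
  by rewrite /c scalerA divff// scale1r.
have cc : c *m c^T = s^-1 *: (Y *m w^T *m w *m Y^T).
  have -> : c^T = r^-1 *: (w *m Y^T).
    rewrite /c; apply/matrixP => i j; rewrite !mxE; congr (_ * _).
    by apply: eq_bigr => l _; rewrite [w^T _ _]mxE [Y^T _ _]mxE mulrC.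
  by rewrite -scalemxAl -scalemxAr scalerA -invfM rr !mulmxA.
have ZZ : Z *m Z^T = Y *m Y^T - c *m c^T.
  have -> : Z^T = Y^T - s^-1 *: (w^T *m (w *m Y^T)).
    have <- : (Y *m w^T *m w)^T = w^T *m (w *m Y^T) by rewrite !trmx_mul trmxK.
    by apply/matrixP => i j; rewrite !mxE.
  rewrite cc /Z.
  rewrite mulmxBl !mulmxBr -!scalemxAl -!scalemxAr.
  have -> : Y *m w^T *m w *m (w^T *m (w *m Y^T)) = s *: (Y *m w^T *m w *m Y^T).
    by rewrite -!mulmxA (mulmxA w w^T) ww mul_scalar_mx -!scalemxAr.
  rewrite (scalerA s^-1 s) !mulmxA.
  have [sz|sz] := eqVneq s 0.
    by rewrite sz invr0 !scale0r !subr0.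
  by rewrite mulVf// scale1r subrr subr0.
rewrite -[W]vsubmxK -/w -/Y tr_col_mx mul_col_row tr_block_mx mulmx_block.
rewrite !trmx0 !mulmx0 !mul0mx !addr0 tr_scalar_mx -ZZ' ZZ addrC subrK.
have cTE : r *: c^T = w *m Y^T.
  have <- : (Y *m w^T)^T = w *m Y^T by rewrite trmx_mul trmxK.
  by rewrite -YwE; apply/matrixP => i j; rewrite !mxE.
by rewrite -scalar_mxM rr ww mul_scalar_mx mul_mx_scalar cTE YwE.
Qed.

Lemma gamma2_values_square (R : realType) (m n k : nat)
    (U : 'M[R]_(m, k)) (V : 'M[R]_(k, n)) :
  exists (U' : 'M[R]_(m, m + n)) (V' : 'M[R]_(m + n, n)),
    [/\ U *m V = U' *m V', norm_2_oo U = norm_2_oo U' &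
        norm_1_2 V = norm_1_2 V'].
Proof.
have [W] := square_gram (col_mx U V^T).
rewrite -[W]vsubmxK; move: (usubmx W) (dsubmx W) => U' V'.
rewrite !tr_col_mx !trmxK !mul_col_row => /eq_block_mx[UU UV _ VV].
exists U', V'^T; split; first exact: UV.
- exact: norm_2_oo_gram.
- by rewrite !norm_1_2_tr trmxK; apply: norm_2_oo_gram; rewrite trmxK.
Qed.

Lemma norm_2_oo_coef (R : realType) (m k : nat) (U : 'M[R]_(m, k)) i j :
  `|U i j| <= norm_2_oo U.
Proof.
apply: (@bigmax_sup _ _ _ _ i) => //.
rewrite -sqrtr_sqr ler_wsqrtr// (bigD1 j)//= lerDl.
by apply: sumr_ge0 => l _; rewrite sqr_ge0.
Qed.

Lemma norm_1_2_coef (R : realType) (k n : nat) (V : 'M[R]_(k, n)) i j :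
  `|V i j| <= norm_1_2 V.
Proof.
by rewrite norm_1_2_tr; have := norm_2_oo_coef V^T j i; rewrite mxE.
Qed.

Lemma norm_2_ooZ (R : realType) (m k : nat) (a : R) (U : 'M[R]_(m, k)) :
  0 <= a -> norm_2_oo (a *: U) = a * norm_2_oo U.
Proof.
move=> a0; rewrite /norm_2_oo.
rewrite (big_morph _ (fun x y => maxr_pMr x y a0) (mulr0 a)).
apply: eq_bigr => i _; rewrite -{2}(ger0_norm a0) -sqrtr_sqr -sqrtrM ?sqr_ge0//.
by rewrite mulr_sumr; congr Num.sqrt; apply: eq_bigr => j _; rewrite mxE exprMn.
Qed.

Lemma norm_1_2Z (R : realType) (k n : nat) (a : R) (V : 'M[R]_(k, n)) :
  0 <= a -> norm_1_2 (a *: V) = a * norm_1_2 V.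
Proof. by move=> a0; rewrite !norm_1_2_tr linearZ /= norm_2_ooZ. Qed.

Lemma norm_2_oo_eq0 (R : realType) (m k : nat) (U : 'M[R]_(m, k)) :
  norm_2_oo U = 0 -> U = 0.
Proof.
move=> U0; apply/matrixP => i j; rewrite mxE; apply/eqP; rewrite -normr_le0.
by rewrite -U0 norm_2_oo_coef.
Qed.

Lemma gamma2_values_balanced (R : realType) (m n k : nat)
    (U : 'M[R]_(m, k)) (V : 'M[R]_(k, n)) :
  exists (U' : 'M[R]_(m, k)) (V' : 'M[R]_(k, n)),
    [/\ U *m V = U' *m V', norm_2_oo U' ^+ 2 = norm_2_oo U * norm_1_2 V &
        norm_1_2 V' ^+ 2 = norm_2_oo U * norm_1_2 V].
Proof.
have z2 : norm_2_oo (0 : 'M[R]_(m, k)) = 0.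
  by rewrite -(scale0r 0) norm_2_ooZ// mul0r.
have z1 : norm_1_2 (0 : 'M[R]_(k, n)) = 0.
  by rewrite -(scale0r 0) norm_1_2Z// mul0r.
have [/norm_2_oo_eq0 ->|u0] := eqVneq (norm_2_oo U) 0.
  by exists 0, 0; rewrite z2 z1 !mul0mx mul0r expr0n.
have [V0|v0] := eqVneq (norm_1_2 V) 0.
  exists 0, 0; rewrite V0 z2 z1 mulr0 expr0n/= mul0mx; split => //.
  have /norm_2_oo_eq0/eqP : norm_2_oo V^T = 0 by rewrite -norm_1_2_tr.
  by rewrite trmx_eq0 => /eqP ->; rewrite mulmx0.
have u1 : 0 < norm_2_oo U by rewrite lt_def u0 norm_2_oo_ge0.
have v1 : 0 < norm_1_2 V by rewrite lt_def v0 norm_1_2_ge0.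
pose a := Num.sqrt (norm_1_2 V / norm_2_oo U).
have q0 : 0 < norm_1_2 V / norm_2_oo U by rewrite divr_gt0.
have a0 : 0 < a by rewrite sqrtr_gt0.
have aa : a ^+ 2 = norm_1_2 V / norm_2_oo U by rewrite sqr_sqrtr// ltW.
exists (a *: U), (a^-1 *: V); split.
- by rewrite -scalemxAl -scalemxAr scalerA divff ?gt_eqF// scale1r.
- by rewrite norm_2_ooZ ?ltW// exprMn aa expr2 mulrA divfK// mulrC.
- by rewrite norm_1_2Z ?invr_ge0 ?ltW// exprMn exprVn aa invf_div expr2 mulrA divfK.
Qed.

Lemma continuous_bigmax (R : realType) (T : topologicalType) (I : Type)
    (r : seq I) (f : I -> T -> R) :
  (forall i, continuous (f i)) ->
  continuous (fun x => \big[Num.max/0]_(i <- r) f i x).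
Proof.
move=> fc; apply: continuous_big => // -[a b].
by apply: (@continuous_max _ _ fst snd) => /=; [exact: cvg_fst|exact: cvg_snd].
Qed.

Lemma continuous_sumr (R : realType) (T : topologicalType) (I : Type)
    (r : seq I) (f : I -> T -> R) :
  (forall i, continuous (f i)) ->
  continuous (fun x => \sum_(i <- r) f i x).
Proof.
move=> fc; apply: continuous_big => // -[a b].
by apply: cvgD => /=; [exact: cvg_fst|exact: cvg_snd].
Qed.

Lemma gamma2_attained (R : realType) (m n : nat) (A : 'M[R]_(m, n)) :
  gamma2_values A (gamma2 A).
Proof.
pose N := (m + n)%N.
pose X := 'rV[R]_(m * N + N * n).
pose fU (x : X) : 'M[R]_(m, N) := vec_mx (lsubmx x).
pose fV (x : X) : 'M[R]_(N, n) := vec_mx (rsubmx x).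
have cU i j : continuous (fun x => fU x i j).
  suff -> : (fun x => fU x i j) = fun x : X => x 0 (lshift _ (mxvec_index i j)).
    exact: coord_continuous.
  by apply/funext => x; rewrite /fU !mxE.
have cV i j : continuous (fun x => fV x i j).
  suff -> : (fun x => fV x i j) = fun x : X => x 0 (rshift _ (mxvec_index i j)).
    exact: coord_continuous.
  by apply/funext => x; rewrite /fV !mxE.
have sq (f : X -> R) : continuous f -> continuous (fun x => f x ^+ 2).
  by move=> fc x; apply: (continuousM (fc x) (fc x)).
have cnU : continuous (fun x => norm_2_oo (fU x)).
  apply: continuous_bigmax => i x.
  apply: continuous_comp; last exact: sqrt_continuous.
  by apply: continuous_sumr => j; apply: sq.
have cnV : continuous (fun x => norm_1_2 (fV x)).
  apply: continuous_bigmax => i x.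
  apply: continuous_comp; last exact: sqrt_continuous.
  by apply: continuous_sumr => j; apply: sq.
pose f (x : X) := norm_2_oo (fU x) * norm_1_2 (fV x).
have cf : continuous f by move=> x; apply: (continuousM (cnU x) (cnV x)).
pose g0 := norm_2_oo A * norm_1_2 (1%:M : 'M[R]_n).
pose M := Num.sqrt g0.
pose K := [set x : X | A = fU x *m fV x] `&`
          [set x : X | forall i, `[- M, M]%classic (x 0 i)].
have cK : compact K.
  rewrite /K setIC; apply: compact_closedI.
    by apply: (rV_compact (A := fun=> `[- M, M]%classic)) => i;
      exact: segment_compact.
  have -> : [set x | A = fU x *m fV x] =
      \bigcap_(i in setT) \bigcap_(j in setT)
         [set x | (fU x *m fV x) i j \in [set A i j]].
    apply/seteqP; split => [x /= -> i _ j _ /=|x xA]; first exact/mem_set.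
    by apply/matrixP => i j; have /set_mem -> := xA i I j I.
  apply: closed_bigI => i _; apply: closed_bigI => j _.
  have -> : [set x | (fU x *m fV x) i j \in [set A i j]] =
      (fun x => (fU x *m fV x) i j) @^-1` [set A i j].
    by apply/seteqP; split => x /=; [exact: set_mem|exact: mem_set].
  apply: preimage_closed; last exact: closed_eq.
  move=> x _.
  have -> : (fun x => (fU x *m fV x) i j) = fun x => \sum_l fU x i l * fV x l j.
    by apply/funext => y; rewrite mxE.
  by apply: continuous_sumr => l {}x; apply: (continuousM (cU _ _ x) (cV _ _ x)).
have small (U : 'M[R]_(m, N)) (V : 'M[R]_(N, n)) : A = U *m V ->
    norm_2_oo U * norm_1_2 V <= g0 ->
    exists2 x, K x & f x = norm_2_oo U * norm_1_2 V.
  move=> AE le0.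
  have [U' [V' [UV U2 V2]]] := gamma2_values_balanced U V.
  have UM : norm_2_oo U' <= M.
    by rewrite -(ger0_norm (norm_2_oo_ge0 U')) -sqrtr_sqr U2 ler_wsqrtr.
  have VM : norm_1_2 V' <= M.
    by rewrite -(ger0_norm (norm_1_2_ge0 V')) -sqrtr_sqr V2 ler_wsqrtr.
  pose x : X := row_mx (mxvec U') (mxvec V').
  have xU : fU x = U' by rewrite /fU row_mxKl mxvecK.
  have xV : fV x = V' by rewrite /fV row_mxKr mxvecK.
  exists x.
    split; first by rewrite /= xU xV AE UV.
    move=> i /=; rewrite in_itv/= -ler_norml.
    rewrite /x mxE; case: splitP => l _; case/mxvec_indexP: l => a b.
      by rewrite mxvecE (le_trans (norm_2_oo_coef _ _ _)).
    by rewrite mxvecE (le_trans (norm_1_2_coef _ _ _)).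
  rewrite /f xU xV; apply/eqP; rewrite -(@eqrXn2 _ 2)//.
  - by rewrite exprMn U2 V2 -expr2.
  - by rewrite mulr_ge0 ?norm_2_oo_ge0 ?norm_1_2_ge0.
  - by rewrite mulr_ge0 ?norm_2_oo_ge0 ?norm_1_2_ge0.
have [U0 [V0 [AE0 nU0 nV0]]] := gamma2_values_square A (1%:M : 'M[R]_n).
rewrite mulmx1 in AE0.
have [x0 Kx0 fx0] : exists2 x, K x & f x = g0.
  have [] := small U0 V0 AE0; first by rewrite -nU0 -nV0.
  by move=> x Kx fx; exists x => //; rewrite fx -nU0 -nV0.
have [c /set_mem Kc cmin] :=
  compact_EVT_min (ex_intro _ x0 Kx0) cK (continuous_subspaceT cf).
have fcP : gamma2_values A (f c) by exists N, (fU c), (fV c); case: Kc.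
have fcL : lbound (gamma2_values A) (f c).
  move=> _ [k [U [V [AE ->]]]].
  have [U' [V' [UV -> ->]]] := gamma2_values_square U V.
  have [le0|/ltW lt0] := leP (norm_2_oo U' * norm_1_2 V') g0.
    have [|x Kx <-] := small U' V' _ le0; first by rewrite AE.
    by apply: cmin; exact: mem_set.
  by apply: le_trans lt0; rewrite -fx0; apply: cmin; exact: mem_set.
suff -> : gamma2 A = f c by [].
apply/eqP; rewrite eq_le; apply/andP; split.
  by apply: ge_inf => //; exists (f c).
by apply: lb_le_inf => //; exists (f c).
Qed.

Lemma gamma2_lb (R : realType) (m n k : nat) (A : 'M[R]_(m, n))
    (U : 'M[R]_(m, k)) (V : 'M[R]_(k, n)) :
  A = U *m V -> gamma2 A <= norm_2_oo U * norm_1_2 V.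
Proof.
move=> AE; apply: ge_inf; last by exists k, U, V.
exists 0 => _ [l [U' [V' [_ ->]]]].
by rewrite mulr_ge0 ?norm_2_oo_ge0 ?norm_1_2_ge0.
Qed.

(* Main.v *)
(* Any d+1 halfspaces in R^d have linearly dependent normals, so some pattern of
   memberships in them never occurs.  Expanding the corresponding identity
   [\prod h_i * \prod (1 - h_i) = 0] writes a product of more than d halfspace
   indicators as a linear combination of products of fewer of them, with
   coefficients depending on the polytope only; hence the indicator of B is a
   combination of products of at most d indicators.  For a homothet of B each
   factor becomes a threshold matrix [f_l(p) <= theta_l(F)], whose gamma_2 is
   O(1 + log n) by binary splitting, and gamma_2 is subadditive, and
   submultiplicative under entrywise products. *)
Require Import Defs.
From mathcomp Require Import all_boot all_order all_algebra finmap.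
From mathcomp Require Import all_classical all_reals all_analysis.
From mathcomp Require Import lra zify.
Set Implicit Arguments.
Unset Strict Implicit.
Unset Printing Implicit Defensive.
Import Order.TTheory GRing.Theory Num.Theory numFieldNormedType.Exports.
Local Open Scope fset_scope.
Local Open Scope classical_set_scope.
Local Open Scope ring_scope.

(** * Calculus of factorizations with bounded squared norms *)

(* Both families of squared norms are bounded by [g], so that [gamma2 M <= g]. *)
Definition factorable (R : realType) (I J : Type) (M : I -> J -> R) (g : R) :=
  exists (K : finType) (u : I -> K -> R) (v : J -> K -> R),
    [/\ forall i j, M i j = \sum_k u i k * v j k,
        forall i, \sum_k u i k ^+ 2 <= g &
        forall j, \sum_k v j k ^+ 2 <= g].

(** Each vector is bounded separately, so [p] and [q] may repeat rows and columns at no cost. *)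
Lemma factorable_reindex (R : realType) (I J I' J' : Type) (M : I -> J -> R)
    (M' : I' -> J' -> R) (p : I' -> I) (q : J' -> J) (g : R) :
  (forall i j, M' i j = M (p i) (q j)) -> factorable M g -> factorable M' g.
Proof.
move=> MM' [K [u [v [Muv ug vg]]]].
exists K, (u \o p), (v \o q); split => [i j|i|j]; first by rewrite MM' Muv.
  exact: ug.
exact: vg.
Qed.

Lemma factorable_ext (R : realType) (I J : Type) (M M' : I -> J -> R) (g : R) :
  (forall i j, M' i j = M i j) -> factorable M g -> factorable M' g.
Proof. exact: (@factorable_reindex _ _ _ _ _ M M' id id). Qed.

Lemma factorable_le (R : realType) (I J : Type) (M : I -> J -> R) (g g' : R) :
  g <= g' -> factorable M g -> factorable M g'.
Proof.
move=> gg' [K [u [v [Muv ug vg]]]]; exists K, u, v; split => // [i|j].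
  exact: le_trans gg'.
exact: le_trans gg'.
Qed.

Lemma factorable0 (R : realType) (I J : Type) :
  factorable (fun (_ : I) (_ : J) => 0 : R) 0.
Proof.
by exists void, (fun _ _ => 0), (fun _ _ => 0); split=> [i j|i|j];
  rewrite big_pred0 // => -[].
Qed.

(** Row [i] gets the basis vector of [phi i] masked by [a], column [j] that of [psi j] masked by
    [b]; the norms stay at most 1 however many blocks there are. *)
Lemma factorable_block (R : realType) (I J : Type) (K : finType)
    (phi : I -> K) (psi : J -> K) (a : pred I) (b : pred J) :
  factorable (fun i j => [&& phi i == psi j, a i & b j]%:R : R) 1.
Proof.
exists K, (fun i k => ((phi i == k) && a i)%:R),
  (fun j k => ((psi j == k) && b j)%:R); split => [i j|i|j].
- rewrite (bigD1 (phi i))//= eqxx big1 ?addr0 => [|k ki].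
    rewrite -natrM mulnb [psi j == _]eq_sym.
    by case: (phi i == psi j); case: (a i); case: (b j).
  by rewrite eq_sym (negbTE ki) mul0r.
- rewrite (bigD1 (phi i))//= big1 ?addr0 => [|k ki].
    by rewrite eqxx; case: (a i); rewrite ?expr1n ?expr0n.
  by rewrite eq_sym (negbTE ki) expr0n.
- rewrite (bigD1 (psi j))//= big1 ?addr0 => [|k kj].
    by rewrite eqxx; case: (b j); rewrite ?expr1n ?expr0n.
  by rewrite eq_sym (negbTE kj) expr0n.
Qed.

Lemma factorable1 (R : realType) (I J : Type) :
  factorable (fun (_ : I) (_ : J) => 1 : R) 1.
Proof.
have := @factorable_block R I J unit (fun=> tt) (fun=> tt) predT predT.
exact: factorable_ext.
Qed.

(** Concatenating the vectors adds inner products and squared norms. *)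
Lemma factorableD (R : realType) (I J : Type) (M N : I -> J -> R) (g h : R) :
  factorable M g -> factorable N h ->
  factorable (fun i j => M i j + N i j) (g + h).
Proof.
move=> [K [u [v [Muv ug vg]]]] [L [w [z [Nwz wh zh]]]].
exists (K + L)%type,
  (fun i k => match k with inl k => u i k | inr k => w i k end),
  (fun j k => match k with inl k => v j k | inr k => z j k end).
split => [i j|i|j]; rewrite big_sumType/=.
- by rewrite Muv Nwz.
- exact: lerD.
- exact: lerD.
Qed.

Lemma factorableZ (R : realType) (I J : Type) (M : I -> J -> R) (c g : R) :
  factorable M g -> factorable (fun i j => c * M i j) (`|c| * g).
Proof.
move=> [K [u [v [Muv ug vg]]]].
have cc : Num.sqrt `|c| ^+ 2 = `|c| by rewrite sqr_sqrtr.
have [s [s1 cs]] : exists s : R, s ^+ 2 <= 1 /\ c = s * `|c|.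
  by exists (Num.sg c); rewrite -numEsg sqr_sg; case: eqP.
(* Each side takes a factor [Num.sqrt |c|], so both bounds scale alike; the sign goes to the
   rows. *)
exists K, (fun i k => s * Num.sqrt `|c| * u i k),
  (fun j k => Num.sqrt `|c| * v j k); split => [i j|i|j].
- rewrite Muv mulr_sumr; apply: eq_bigr => k _.
  by rewrite mulrACA -(mulrA s) -expr2 cc -cs.
- rewrite (eq_bigr (fun k => (s ^+ 2 * `|c|) * u i k ^+ 2)); last first.
    by move=> k _; rewrite !exprMn cc.
  rewrite -mulr_sumr ler_pM//.
  + by rewrite mulr_ge0// sqr_ge0.
  + by apply: sumr_ge0 => k _; exact: sqr_ge0.
  + by rewrite ler_piMl.
- rewrite (eq_bigr (fun k => `|c| * v j k ^+ 2)); last first.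
    by move=> k _; rewrite !exprMn cc.
  by rewrite -mulr_sumr ler_wpM2l.
Qed.

(** Tensoring the vectors multiplies inner products and squared norms. *)
Lemma factorableM (R : realType) (I J : Type) (M N : I -> J -> R) (g h : R) :
  factorable M g -> factorable N h ->
  factorable (fun i j => M i j * N i j) (g * h).
Proof.
move=> [K [u [v [Muv ug vg]]]] [L [w [z [Nwz wh zh]]]].
have sum_prod (a : K -> R) (b : L -> R) :
    \sum_(k : K * L) a k.1 * b k.2 = (\sum_k a k) * (\sum_l b l).
  rewrite big_distrlr/= pair_bigA; exact: eq_bigr.
exists (K * L)%type, (fun i k => u i k.1 * w i k.2),
  (fun j k => v j k.1 * z j k.2).
split => [i j|i|j].
- rewrite Muv Nwz -sum_prod; apply: eq_bigr => k _; exact: mulrACA.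
- under eq_bigr do rewrite exprMn.
  rewrite (sum_prod (fun k => u i k ^+ 2) (fun l => w i l ^+ 2)).
  by rewrite ler_pM// sumr_ge0// => k _; exact: sqr_ge0.
- under eq_bigr do rewrite exprMn.
  rewrite (sum_prod (fun k => v j k ^+ 2) (fun l => z j l ^+ 2)).
  by rewrite ler_pM// sumr_ge0// => k _; exact: sqr_ge0.
Qed.

Lemma factorable_sum (R : realType) (I J L : Type) (r : seq L) (P : pred L)
    (M : L -> I -> J -> R) (g : L -> R) :
  (forall l, P l -> factorable (M l) (g l)) ->
  factorable (fun i j => \sum_(l <- r | P l) M l i j) (\sum_(l <- r | P l) g l).
Proof.
move=> Mg; elim: r => [|l r IH].
  by rewrite big_nil; apply: factorable_ext (factorable0 R I J) => i j;
    rewrite big_nil.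
rewrite big_cons; case: ifPn => Pl.
  by apply: factorable_ext (factorableD (Mg l Pl) IH) => i j;
    rewrite big_cons Pl.
by apply: factorable_ext IH => i j; rewrite big_cons (negbTE Pl).
Qed.

Lemma factorable_prod (R : realType) (I J : Type) (L : finType) (T : {set L})
    (M : L -> I -> J -> R) (g : R) :
  (forall l, l \in T -> factorable (M l) g) ->
  factorable (fun i j => \prod_(l in T) M l i j) (g ^+ #|T|).
Proof.
move=> Mg; rewrite -prodr_const.
elim: (index_enum L) => [|l r IH].
  by rewrite big_nil; apply: factorable_ext (factorable1 R I J) => i j;
    rewrite big_nil.
rewrite big_cons; case: ifPn => Pl.
  by apply: factorable_ext (factorableM (Mg l Pl) IH) => i j;
    rewrite big_cons Pl.
by apply: factorable_ext IH => i j; rewrite big_cons (negbTE Pl).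
Qed.

(** * Threshold matrices and the passage to [gamma2] *)

(* Comparing [q] and [r] by their halves leaves only the case
   [q./2 = r./2], [q] odd, [r] even, which is a block-diagonal correction. *)
Lemma factorable_ltn (R : realType) (h : nat) :
  factorable (fun q r : 'I_(2 ^ h) => (r < q)%:R : R) h%:R.
Proof.
elim: h => [|h IH].
  by apply: factorable_ext (factorable0 R _ _) => q r; rewrite !ord1.
have half_lt (q : 'I_(2 ^ h.+1)) : (q./2 < 2 ^ h)%N.
  by have := ltn_ord q; rewrite {2}expnS; lia.
pose half q := Ordinal (half_lt q).
rewrite -natr1.
apply: factorable_ext (factorableD
  (factorable_reindex (p := half) (q := half) (fun _ _ => erefl) IH)
  (@factorable_block R _ _ _ half half (fun q => odd q) (fun r => ~~ odd r))).
move=> q r /=; rewrite -val_eqE/= -natrD; congr _%:R.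
have := odd_double_half q; have := odd_double_half r.
case: (odd q); case: (odd r) => /=; lia.
Qed.

(** Only ranks matter: [f j <= t i] holds exactly when fewer values of [f] are below [f j] strictly
    than are below [t i] weakly. This reduces to comparing integers of [h] bits. *)
Lemma factorable_threshold (R : realType) (I : Type) (J : finType)
    (f : J -> R) (t : I -> R) :
  factorable (fun i j => (f j <= t i)%R%:R : R) (trunc_log 2 #|J|).+1%:R.
Proof.
(* The ranks can reach [#|J|] itself, so [2 ^ h] must exceed it. *)
set h := (trunc_log 2 #|J|).+1.
have card_lt (A : pred J) : (#|A| < 2 ^ h)%N.
  exact: leq_ltn_trans (max_card _) (trunc_log_ltn _ _).
pose q i := Ordinal (card_lt [pred j | (f j <= t i)%R]).
pose r j := Ordinal (card_lt [pred j' | (f j' < f j)%R]).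
apply: (factorable_reindex (p := q) (q := r)) (factorable_ltn R h) => i j /=.
congr (nat_of_bool _)%:R; case: (leP (f j) (t i)) => fj; apply/esym.
  apply/proper_card/properP; split.
    by apply/fintype.subsetP => j'; rewrite !inE => /ltW/le_trans; apply.
  by exists j; rewrite !inE ?ltxx.
apply/negbTE; rewrite -leqNgt; apply: subset_leq_card.
by apply/fintype.subsetP => j'; rewrite !inE => /le_lt_trans; apply.
Qed.

Lemma gamma2_factorable (R : realType) (m n : nat) (A : 'M[R]_(m, n)) (g : R) :
  0 <= g -> factorable (fun i j => A i j) g -> gamma2 A <= g.
Proof.
move=> g0 [K [u [v [Auv ug vg]]]].
pose U : 'M[R]_(m, #|K|) := \matrix_(i, k) u i (enum_val k).
pose V : 'M[R]_(#|K|, n) := \matrix_(k, j) v j (enum_val k).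
have sumE (F : K -> R) : \sum_(k < #|K|) F (enum_val k) = \sum_k F k.
  by rewrite [RHS](reindex (@enum_val K predT))//; apply: onW_bij;
    exact: enum_val_bij.
have AE : A = U *m V.
  apply/matrixP => i j; rewrite Auv mxE -sumE.
  by apply: eq_bigr => k _; rewrite !mxE.
apply: (le_trans (gamma2_lb AE)).
rewrite -[leRHS](sqr_sqrtr g0) expr2 ler_pM ?norm_2_oo_ge0 ?norm_1_2_ge0//.
  apply: bigmax_le => [|i _]; first exact: sqrtr_ge0.
  rewrite ler_wsqrtr// (le_trans _ (ug i))// -sumE.
  by under eq_bigr do rewrite mxE.
apply: bigmax_le => [|j _]; first exact: sqrtr_ge0.
rewrite ler_wsqrtr// (le_trans _ (vg j))// -sumE.
by under eq_bigr do rewrite mxE.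
Qed.

(** * Linear relations among products of halfspace indicators *)

Definition halfspace_ind (R : realType) (d k : nat) (N : 'M[R]_(k, d))
    (b : 'cV[R]_k) (i : 'I_k) (y : 'cV[R]_d) : R := ((N *m y) i 0 <= b i 0)%R%:R.

(** The rows of [N] picked by [S] form a matrix of rank at most [d], so its left kernel is nonzero;
    [E] extends a kernel vector by zero outside [S]. *)
Lemma row_dependency (R : fieldType) (d k : nat) (N : 'M[R]_(k, d))
    (S : {set 'I_k}) :
  (d < #|S|)%N ->
  exists l : 'rV[R]_k, [/\ l *m N = 0, l != 0 & forall i, i \notin S -> l 0 i = 0].
Proof.
move=> dS.
pose E : 'M[R]_(#|S|, k) := rowsub enum_val 1%:M.
have : kermx (E *m N) != 0.
  by rewrite kermx_eq0 /row_free; have := rank_leq_col (E *m N); lia.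
case/rowV0Pn => v /sub_kermxP vEN v0.
have lE a : (v *m E) 0 (enum_val a) = v 0 a.
  rewrite mxE (bigD1 a)//= big1 ?addr0 => [|c ca]; rewrite !mxE.
    by rewrite eqxx mulr1.
  by rewrite (inj_eq enum_val_inj) (negbTE ca) mulr0.
exists (v *m E); split; first by rewrite -mulmxA.
  by apply: contra_neq v0 => l0; apply/rowP => a; rewrite -lE l0 !mxE.
move=> i iS; rewrite mxE big1// => c _; rewrite !mxE.
by case: eqP => [ci|_]; rewrite ?mulr0// -ci enum_valP in iS *.
Qed.

(* The slacks [b i - N i y] satisfy an affine relation [\sum_i l i * s i = beta],
   which excludes one pattern of signs of the slacks. *)
Lemma excluded_pattern (R : realType) (d k : nat) (N : 'M[R]_(k, d))
    (b : 'cV[R]_k) (S : {set 'I_k}) :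
  (d < #|S|)%N ->
  exists2 D : {set 'I_k}, D \subset S &
    forall y : 'cV[R]_d, ~ (forall i, i \in S ->
      ((N *m y) i 0 <= b i 0) = (i \notin D)).
Proof.
move=> /(row_dependency N)[l0 [l0N l00 l0S]].
(* The sign of the relation is chosen so that its constant is negative, or zero with some negative
   coefficient. *)
have [l [lN lS lb]] : exists l : 'rV[R]_k,
    [/\ l *m N = 0, forall i, i \notin S -> l 0 i = 0 &
        (l *m b) 0 0 < 0 \/ (l *m b) 0 0 = 0 /\ exists i, l 0 i < 0].
  have l0'S i : i \notin S -> (- l0) 0 i = 0.
    by move=> iS; rewrite mxE l0S// oppr0.
  have l0'N : - l0 *m N = 0 by rewrite mulNmx l0N oppr0.
  have [bN|b0|bE] := ltgtP ((l0 *m b) 0 0) 0.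
  - by exists l0; split => //; left.
  - by exists (- l0); split => //; left; rewrite mulNmx mxE oppr_lt0.
  have [i li] : exists i, l0 0 i != 0.
    apply/existsP; apply: contra_neqT l00; rewrite negb_exists => /forallP l0E.
    by apply/rowP => i; rewrite mxE; apply/eqP; rewrite -[_ == _]negbK.
  have [ln|lp|lE] := ltgtP (l0 0 i) 0.
  - by exists l0; split => //; right; split => //; exists i.
  - exists (- l0); split => //; right; split; first by rewrite mulNmx mxE bE oppr0.
    by exists i; rewrite mxE oppr_lt0.
  - by rewrite lE eqxx in li.
(* Under this pattern slacks are negative where [l] is, and nonnegative elsewhere in [S]. Every term
   is then nonnegative, and positive on [D], contradicting the sign of the constant. *)
exists [set i | l 0 i < 0]%SET.
  apply/fintype.subsetP => i; rewrite inE => li; apply: contraLR li => /lS ->.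
  by rewrite ltxx.
move=> y pat.
pose s i := l 0 i * (b i 0 - (N *m y) i 0).
have sumE : \sum_i s i = (l *m b) 0 0.
  have -> : (l *m b) 0 0 = (l *m (b - N *m y)) 0 0.
    by rewrite mulmxBr mulmxA lN mul0mx subr0.
  by rewrite [RHS]mxE; apply: eq_bigr => i _; rewrite /s !mxE.
have sneg i : l 0 i < 0 -> 0 < s i.
  move=> li; have iS : i \in S by apply: contraLR li => /lS ->; rewrite ltxx.
  have := pat i iS; rewrite inE li/= => /negbT; rewrite -ltNge => bi.
  by rewrite /s nmulr_rgt0// subr_lt0.
have s_ge0 i : 0 <= s i.
  have [iS|/lS l0i] := boolP (i \in S); last by rewrite /s l0i mul0r.
  have [li|li] := ltP (l 0 i) 0; first exact/ltW/sneg.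
  by rewrite mulr_ge0// subr_ge0 pat// inE -leNgt.
case: lb => [|[lb [i li]]].
  by rewrite -sumE ltNge sumr_ge0.
have := sumE; rewrite lb (bigD1 i)//= => /eqP; rewrite gt_eqF//.
by rewrite ltr_wpDr ?sneg// sumr_ge0.
Qed.

(** Since pattern [D] never occurs, the product of [1 - h i] over [D] and [h i] over the rest of [S]
    vanishes. In its expansion the term of [S] has coefficient 1 or -1, so it can be solved for. *)
Lemma halfspace_prod_reduce (R : realType) (d k : nat) (N : 'M[R]_(k, d))
    (b : 'cV[R]_k) (S : {set 'I_k}) :
  (d < #|S|)%N ->
  exists c : {set 'I_k} -> R, forall y,
    \prod_(i in S) halfspace_ind N b i y =
    \sum_(T : {set 'I_k} | T \proper S)
      c T * \prod_(i in T) halfspace_ind N b i y.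
Proof.
move=> /(excluded_pattern N b)[D DS pat].
(* The factor [s i * h i + g i] is [1 - h i] on [D], [h i] on the rest of [S], and 1 outside [S];
   [e T] is the coefficient of the term of [T]. *)
pose s i : R := if i \in D then -1 else (i \in S)%:R.
pose g i : R := if i \in (S :\: D)%SET then 0 else 1.
pose e (T : {set 'I_k}) : R := \prod_i (if i \in T then s i else g i).
have eS : e S != 0.
  apply/prodf_neq0 => i _; rewrite /s /g; case: ifPn => iS.
    by rewrite iS; case: ifP => _; rewrite ?oppr_eq0 oner_eq0.
  by rewrite !inE (negbTE iS) andbF oner_eq0.
have e0 (T : {set 'I_k}) : ~~ (T \subset S) -> e T = 0.
  case/fintype.subsetPn => i iT iS; rewrite /e (bigD1 i)//= iT /s.
  by rewrite (contraNF (fun iD => fintype.subsetP DS i iD) iS) (negbTE iS) mul0r.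
exists (fun T => - (e S)^-1 * e T) => y.
set h := fun i => halfspace_ind N b i y.
have hE i : h i = ((N *m y) i 0 <= b i 0)%R%:R by [].
have : \prod_i (s i * h i + g i) = 0.
  have [i iS iD] : exists2 i, i \in S &
      ((N *m y) i 0 <= b i 0) != (i \notin D).
    apply/exists_inP; apply: contra_notT (pat y).
    rewrite negb_exists_in => /forall_inP H i iS.
    by apply/eqP; rewrite -[_ == _]negbK H.
  rewrite (bigD1 i)//= hE /s /g !inE iS andbT.
  move: iD; case: (i \in D); case: (_ <= _) => //= _.
    by rewrite mulr1 addNr mul0r.
  by rewrite mulr0 addr0 mul0r.
rewrite bigA_distr.
have termE (T : {set 'I_k}) : \prod_i (if i \in T then s i * h i else g i) =
    e T * \prod_(i in T) h i.
  rewrite /e [X in _ * X]big_mkcond -big_split/=; apply: eq_bigr => i _.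
  by case: ifP => _; rewrite ?mulr1.
under eq_bigr do rewrite termE.
rewrite (bigD1 S)//= (bigID (fun T : {set 'I_k} => T \subset S))/= [X in _ + (_ + X)]big1.
  rewrite addr0 => /eqP; rewrite addr_eq0 => /eqP/(congr1 ( *%R (e S)^-1)).
  rewrite mulrA mulVf// mul1r => ->.
  rewrite mulrN -mulNr mulr_sumr; apply: eq_big => [T|T _]; last first.
    by rewrite mulrA.
  by rewrite finset.properEneq.
by move=> T /andP[_ /e0 ->]; rewrite mul0r.
Qed.

(** Strong induction on [#|S|]. The coefficients are chosen before [y], so the same ones serve all
    points and all homothets. *)
Lemma halfspace_prod_small (R : realType) (d k : nat) (N : 'M[R]_(k, d))
    (b : 'cV[R]_k) (S : {set 'I_k}) :
  exists c : {set 'I_k} -> R, forall y,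
    \prod_(i in S) halfspace_ind N b i y =
    \sum_(T : {set 'I_k} | (#|T| <= d)%N)
      c T * \prod_(i in T) halfspace_ind N b i y.
Proof.
have [m] := ubnP #|S|; elim: m S => // m IH S Sm.
have [Sd|dS] := leqP #|S| d.
  exists (fun T => (T == S)%:R) => y.
  rewrite [RHS](bigD1 S)//= eqxx mul1r [X in _ + X]big1 ?addr0// => T /andP[_ /negbTE ->].
  by rewrite mul0r.
have [c cE] := halfspace_prod_reduce N b dS.
have /choice[c' c'E] (T : {set 'I_k}) : exists c' : {set 'I_k} -> R,
    T \proper S -> forall y, \prod_(i in T) halfspace_ind N b i y =
    \sum_(T' : {set 'I_k} | (#|T'| <= d)%N)
      c' T' * \prod_(i in T') halfspace_ind N b i y.
  have [TS|_] := boolP (T \proper S); last by exists (fun=> 0).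
  have [|c' c'E] := IH T; last by exists c'.
  exact: leq_trans (proper_card TS) _.
exists (fun T' => \sum_(T : {set 'I_k} | T \proper S) c T * c' T T') => y.
rewrite cE; under [RHS]eq_bigr do rewrite mulr_suml.
rewrite [RHS]exchange_big/=; apply: eq_bigr => T TS.
rewrite c'E// mulr_sumr; apply: eq_bigr => T' _; exact: mulrA.
Qed.

(** * Homothets of the polytope and the final bound *)

Lemma homothet_halfspaces (R : realType) (d k : nat) (N : 'M[R]_(k, d))
    (b : 'cV[R]_k) (t : R) (x p : 'cV[R]_d) : 0 < t ->
  [set t *: y + x | y in halfspace_intersection N b] p <->
  halfspace_intersection N b (t^-1 *: (p - x)).
Proof.
move=> t0; split => [[y Ny <-]|Np].
  by rewrite addrK scalerA mulVf ?gt_eqF// scale1r.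
by exists (t^-1 *: (p - x)) => //; rewrite scalerA divff ?gt_eqF// scale1r subrK.
Qed.

(** The left side of the inequality depends on the point only, the right side on the homothet only:
    this is a threshold matrix. *)
Lemma halfspace_ind_homothet (R : realType) (d k : nat) (N : 'M[R]_(k, d))
    (b : 'cV[R]_k) (t : R) (x p : 'cV[R]_d) (i : 'I_k) : 0 < t ->
  halfspace_ind N b i (t^-1 *: (p - x)) =
  ((N *m p) i 0 <= t * b i 0 + (N *m x) i 0)%R%:R.
Proof.
move=> t0; rewrite /halfspace_ind -scalemxAr mulmxBr mxE ler_pdivrMl//.
by rewrite !mxE lerBlDr.
Qed.

Lemma halfspace_prodE (R : realType) (d k : nat) (N : 'M[R]_(k, d))
    (b : 'cV[R]_k) (y : 'cV[R]_d) :
  \prod_(i in [set: 'I_k]%SET) halfspace_ind N b i y =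
  `[< halfspace_intersection N b y >]%:R.
Proof.
case: asboolP => [Ny|Ny].
  by rewrite big1// => i _; rewrite /halfspace_ind Ny.
have /existsNP[i /negP Ni] := Ny.
by rewrite (bigD1 i) ?inE//= /halfspace_ind (negbTE Ni) mul0r.
Qed.

Lemma trunc_log_le_ln (R : realType) (n : nat) :
  (trunc_log 2 n).+1%:R <= (1 + (ln 2)^-1) * (1 + ln n%:R) :> R.
Proof.
have ln2 : 0 < ln 2 :> R by rewrite ln_gt0// ltr1n.
(* Here [ln 0] is 0, which covers the empty point set. *)
case: n => [|n]; first by rewrite trunc_log0 (ln0 (lexx 0)) addr0 mulr1 lerDl invr_ge0 ltW.
have lnn : 0 <= ln n.+1%:R :> R by rewrite ln_ge0// ler1n.
have : (trunc_log 2 n.+1)%:R * ln 2 <= ln n.+1%:R :> R.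
  rewrite mulr_natl -lnXn// ler_ln ?posrE ?exprn_gt0 ?ltr0n//.
  by rewrite -natrX ler_nat trunc_logP.
rewrite -ler_pdivlMr// mulrC => le_log.
rewrite -natr1 mulrDr mulr1 mulrDl mul1r (le_trans (lerD le_log (lexx 1)))//.
have : 0 <= (ln 2)^-1 :> R by rewrite invr_ge0 ltW.
move: le_log; lra.
Qed.

Theorem theorem7 (R : realType) (d : nat) (B : set 'cV[R]_d) :
  (1 <= d)%N -> closed_convex_polytope B ->
  exists C : R, forall (n : nat) (P : {fset 'cV[R]_d}),
    #|` P| = n ->
    gamma2_sys R P (trace (homothets B) P) <= C * (1 + ln n%:R) ^+ d.
Proof.
move=> _ [_ [k [N [b ->]]]].
have [c cE] := halfspace_prod_small N b [set: 'I_k]%SET.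
pose a : R := 1 + (ln 2)^-1.
(* Each [T] costs its coefficient times at most [d] threshold factors, each bounded by
   [a * (1 + ln n)]. *)
exists ((\sum_(T : {set 'I_k} | (#|T| <= d)%N) `|c T|) * a ^+ d) => n P Pn.
set F := trace _ P.
pose g : R := a * (1 + ln n%:R).
(* This allows raising the exponent from [#|T|] to [d]. *)
have g1 : 1 <= g.
  by apply: le_trans (trunc_log_le_ln R n); rewrite ler1n.
(* For every trace, one homothet cutting it out is fixed. *)
have /choice[tx txE] (i : 'I_#|{: F}|) : exists tx : R * 'cV[R]_d, 0 < tx.1 /\
    forall p, p \in P -> (p \in val (enum_val i)) =
      `[< halfspace_intersection N b (tx.1^-1 *: (p - tx.2)) >].
  have [|G [t [x [t0 GE]]] SG] :=
    (traceP (homothets (halfspace_intersection N b)) P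
      [set` val (enum_val i)]).1.
    by exists (val (enum_val i)) => //; exact: valP.
  exists (t, x); split => // p pP /=.
  apply/idP/asboolP => [pS|pN].
    have : [set` val (enum_val i)] p by [].
    by rewrite SG GE => -[/(homothet_halfspaces N b x p t0)].
  suff : [set` val (enum_val i)] p by [].
  by rewrite SG GE; split => //; exact/homothet_halfspaces.
rewrite /gamma2_sys -mulrA -exprMn.
apply: gamma2_factorable.
  by rewrite mulr_ge0 ?sumr_ge0// exprn_ge0// (le_trans ler01).
pose M (T : {set 'I_k}) (i : 'I_#|{: F}|) (j : 'I_#|{: P}|) : R := \prod_(l in T)
  ((N *m val (enum_val j)) l 0 <= (tx i).1 * b l 0 + (N *m (tx i).2) l 0)%R%:R.
apply: (@factorable_ext _ _ _
    (fun i j => \sum_(T : {set 'I_k} | (#|T| <= d)%N) c T * M T i j)).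
  move=> i j; rewrite mxE; have [t0 ->] := txE i; last exact: valP.
  rewrite -halfspace_prodE cE; apply: eq_bigr => T _; congr (_ * _).
  by apply: eq_bigr => l _; rewrite halfspace_ind_homothet.
rewrite mulr_suml; apply: factorable_sum => T Td; apply: factorableZ.
apply: (@factorable_le _ _ _ _ (g ^+ #|T|)); first exact: ler_weXn2l.
apply: factorable_prod => l _.
have Pcard : #|'I_#|{: P}| | = n by rewrite card_ord -cardfE.
apply: factorable_le (factorable_threshold _ _).
by rewrite Pcard; exact: trunc_log_le_ln.
Qed.
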